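(* Let $q\ge1$. For every $j=1,\dots,q$, the completely diagonal coefficient $\kappa_{j,q}:=\widetilde V^{(q)}_{jjjj}$ of $\widetilde{\mathsf V}_q^{(4)}$ satisfies \[ \kappa_{j,q}=\sum_{\ell=1}^{2}\pi_\ell\,\mathbb E\bigl(Q_{\ell j}^{2}\bigr)=3+2\rho\,\widetilde\nu_j^{\,2}+\rho(1-3\rho)\,\widetilde\nu_j^{\,4}. \]
   Context: Let $H=L^2([0,1])$ (real) with its usual inner product. For $f,g\in H$, $f\otimes g$ is the rank-one operator $(f\otimes g)(h)=\langle h,g\rangle f$. Let $X_\ell\sim\mathbb G(m_\ell,\mathsf K)$, $\ell=1,2$, be Gaussian random elements of $H$ with means $m_1,m_2\in H$ and common covariance operator $\mathsf K$ induced by a continuous covariance kernel; $\mathsf K$ is self-adjoint, positive and trace class. Fix an orthonormal basis $\{\gamma_j\}_{j\ge1}$ of $H$ with $\mathsf K\gamma_j=\lambda_j\gamma_j$, $\lambda_1\ge\lambda_2\ge\cdots$, and assume $\lambda_j>0$ for all $j$. Let $m_\Delta=m_2-m_1=\sum_j\nu_j\gamma_j$ and $\widetilde\nu_j=\nu_j/\sqrt{\lambda_j}$. Fix $0<\alpha<1$ and set $\rho=\alpha(1-\alpha)$, $\pi_1=\alpha$, $\pi_2=1-\alpha$, $a_1=-(1-\alpha)$, $a_2=\alpha$. Let $H_q=\operatorname{span}\{\gamma_1,\dots,\gamma_q\}$ and let $\mathcal L_2(H_q)$ be the Hilbert--Schmidt operators on $H_q$ with the Hilbert--Schmidt inner product.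 Let $\zeta_{\ell j}=\langle X_\ell-m_\ell,\gamma_j\rangle_H/\sqrt{\lambda_j}$; for each $\ell$, these are independent standard Gaussian variables. Define \[ \widetilde{\mathsf V}^{(2)}_{\ell,q}=\sum_{j,k=1}^{q}\bigl(\zeta_{\ell j}\zeta_{\ell k}+a_\ell^2\widetilde\nu_j\widetilde\nu_k\bigr)(\gamma_j\otimes\gamma_k), \qquad \widetilde{\mathsf V}_q^{(4)}=\sum_{\ell=1}^2\pi_\ell\,\mathbb E\bigl(\widetilde{\mathsf V}^{(2)}_{\ell,q}\otimes\widetilde{\mathsf V}^{(2)}_{\ell,q}\bigr), \] and let $\widetilde V^{(q)}_{jkmn}$ be its coefficients in the expansion $\widetilde{\mathsf V}_q^{(4)}=\sum_{j,k,m,n=1}^q\widetilde V^{(q)}_{jkmn}\,\gamma_j\otimes\gamma_k\otimes\gamma_m\otimes\gamma_n$, that is, \[ \widetilde V^{(q)}_{jkmn}=\sum_{\ell=1}^2\pi_\ell\,\mathbb E\bigl[(\zeta_{\ell j}\zeta_{\ell k}+a_\ell^2\widetilde\nu_j\widetilde\nu_k)(\zeta_{\ell m}\zeta_{\ell n}+a_\ell^2\widetilde\nu_m\widetilde\nu_n)\bigr]. \] Finally, \[ Q_{\ell j}:=\bigl\langle\widetilde{\mathsf V}^{(2)}_{\ell,q},\gamma_j\otimes\gamma_j\bigr\rangle_{\mathcal L_2(H_q)}=\zeta_{\ell j}^2+a_\ell^2\widetilde\nu_j^{\,2}. \] *)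

(* Defs.v *)
From HB Require Import structures.
From mathcomp Require Import all_boot all_order all_algebra.
From mathcomp Require Import all_classical all_reals all_analysis.

Set Implicit Arguments.
Unset Strict Implicit.
Unset Printing Implicit Defensive.

Import Order.TTheory GRing.Theory Num.Theory.
Import numFieldNormedType.Exports.

Local Open Scope classical_set_scope.
Local Open Scope ring_scope.

Section L2.
Context (R : realType).

Definition leb01 : {measure set (measurableTypeR R) -> \bar R} :=
  mrestr (@lebesgue_measure R) (measurable_itv `[0%R, 1%R]%R).

(* Square-integrable representatives: two elements denote the same vector of
   the Hilbert space L^2([0,1]) when they are equal leb01-a.e.  The quotient
   type [LspaceType] carries no linear structure in the library.  Everything
   below depends on the a.e. class only, through [dotH] or through
   equalities [%[ae leb01]]. *)
Definition H := LfunType leb01 (lee1n 2).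

Definition dotH (f g : H) : R := \int[leb01]_x (f x * g x).

Definition normH (f : H) : R := Num.sqrt (dotH f f).

(* The family is indexed from 0: [g j] is the (j+1)-st basis vector. *)
Definition orthonormal_basis (g : nat -> H) : Prop :=
  (forall i j, dotH (g i) (g j) = (i == j)%:R) /\
  (forall f : H,
    normH (f - \sum_(j < n) dotH f (g j) *: g j) @[n --> \oo] --> (0 : R)).

Definition self_adjoint (K : H -> H) : Prop :=
  forall f g, dotH (K f) g = dotH f (K g).

Definition positive_op (K : H -> H) : Prop := forall f, 0 <= dotH (K f) f.

(* Finiteness of the trace; for a positive operator |K| = K, so this is
   membership in the trace class. *)
Definition finite_trace (K : H -> H) : Prop :=
  forall e, orthonormal_basis e ->
    cvgn (series (fun j => dotH (K (e j)) (e j))).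

Definition covariance_kernel (k : R -> R -> R) : Prop :=
  (forall s t, k s t = k t s) /\
  (forall (n : nat) (t c : 'I_n -> R), (forall i, t i \in `[0, 1]) ->
    0 <= \sum_i \sum_j c i * c j * k (t i) (t j)).

Definition kernel_continuous (k : R -> R -> R) : Prop :=
  {within `[0, 1] `*` `[0, 1], continuous (fun st : R * R => k st.1 st.2)}.

Definition induced_by (k : R -> R -> R) (K : H -> H) : Prop :=
  forall f : H, (K f : R -> R) = (fun s => \int[leb01]_t (k s t * f t))
    %[ae leb01].

Definition tens (f g : H) : H -> H := fun h => dotH h g *: f.

End L2.

Arguments H : clear implicits.

Section Gaussian.
Context (R : realType).

(* [normal_prob m 0] is the uniform law on [0,1] in the library, hence the
   separate treatment of variance zero. *)
Definition gauss_law (m v : R) (A : set (measurableTypeR R)) : \bar R :=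
  if v == 0 then \d_m A else normal_prob m (Num.sqrt v) A.

(* As L^2([0,1]) is separable, measurability of all the <X, h> amounts to
   Borel measurability of X. *)
Definition gaussian_element (d : measure_display) (T : measurableType d)
    (P : probability T R) (X : T -> H R) (m : H R) (K : H R -> H R) : Prop :=
  forall h : H R,
    measurable_fun [set: T] (fun w => dotH (X w) h) /\
    forall A : set (measurableTypeR R), measurable A ->
      P ((fun w => dotH (X w) h) @^-1` A) =
        gauss_law (dotH m h) (dotH (K h) h) A.

End Gaussian.

(* Hilbert-Schmidt operators on H_q = span (gamma_0, ..., gamma_(q-1)),
   represented by operators on H. *)
Section HilbertSchmidt.
Context (R : realType) (gamma : nat -> H R) (q : nat).

Definition dotHS (A B : H R -> H R) : R :=
  \sum_(i < q) dotH (A (gamma i)) (B (gamma i)).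

Definition tensHS (A B : H R -> H R) : (H R -> H R) -> (H R -> H R) :=
  fun C => dotHS C B *: A.

(* Expectation in the finite-dimensional space L_2(H_q), taken along its
   orthonormal basis (gamma_j (x) gamma_k); only meaningful when the
   coordinates of A are integrable, as [fine] sends infinities to 0. *)
Definition meanHS (d : measure_display) (T : measurableType d)
    (P : probability T R) (A : T -> H R -> H R) : H R -> H R :=
  \sum_(j < q) \sum_(k < q)
    fine ('E_P[fun w => dotHS (A w) (tens (gamma j) (gamma k))])
      *: tens (gamma j) (gamma k).

(* Coefficient of an operator on L_2(H_q) along
   gamma_j (x) gamma_k (x) gamma_m (x) gamma_n, read as the element
   tensHS (gamma_j (x) gamma_k) (gamma_m (x) gamma_n)
   of an orthonormal basis of the Hilbert-Schmidt operators on L_2(H_q). *)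
Definition coef4 (V : (H R -> H R) -> (H R -> H R)) (j k m n : 'I_q) : R :=
  dotHS (V (tens (gamma m) (gamma n))) (tens (gamma j) (gamma k)).

End HilbertSchmidt.

(* The populations 1 and 2 are indexed by [ord0] and [ord_max] in 'I_2. *)
Section Model.
Context (R : realType) (d : measure_display) (T : measurableType d)
  (P : probability T R).
Context (gamma : nat -> H R) (lambda : nat -> R).
Context (X : 'I_2 -> T -> H R) (m : 'I_2 -> H R) (alpha : R).

Definition rho : R := alpha * (1 - alpha).

Definition prior (l : 'I_2) : R := if l == ord0 then alpha else 1 - alpha.

Definition acoef (l : 'I_2) : R := if l == ord0 then - (1 - alpha) else alpha.

Definition nu (j : nat) : R := dotH (m ord_max - m ord0) (gamma j).

Definition nut (j : nat) : R := nu j / Num.sqrt (lambda j).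

Definition zeta (l : 'I_2) (j : nat) (w : T) : R :=
  dotH (X l w - m l) (gamma j) / Num.sqrt (lambda j).

Definition V2 (q : nat) (l : 'I_2) (w : T) : H R -> H R :=
  \sum_(j < q) \sum_(k < q)
    (zeta l j w * zeta l k w + acoef l ^+ 2 * nut j * nut k)
      *: tens (gamma j) (gamma k).

Definition V4 (q : nat) : (H R -> H R) -> (H R -> H R) := fun C =>
  \sum_(l < 2) prior l *:
    meanHS gamma q P (fun w => tensHS gamma q (V2 q l w) (V2 q l w) C).

Definition kappa (q : nat) (j : 'I_q) : R := coef4 gamma (V4 q) j j j j.

Definition Q (q : nat) (l : 'I_2) (j : 'I_q) (w : T) : R :=
  dotHS gamma q (V2 q l w) (tens (gamma j) (gamma j)).

End Model.

(* Main.v *)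
Require Import Defs.
From HB Require Import structures.
From mathcomp Require Import all_boot all_order all_algebra.
From mathcomp Require Import all_classical all_reals all_analysis.
From mathcomp Require Import measurable_realfun ring lra.
Import Order.TTheory GRing.Theory Num.Theory.
Import numFieldNormedType.Exports.
Local Open Scope classical_set_scope.
Local Open Scope ring_scope.

(* The coordinate <X_l, gamma_j> is N(<m_l, gamma_j>, lambda_j), so zeta_lj is
   standard normal, and Q_lj = zeta_lj^2 + c with c = (a_l v)^2.  With E zeta^2 = 1
   and E zeta^4 = 3 this gives E Q_lj^2 = 3 + 2c + c^2; averaging over l with the
   weights alpha and 1 - alpha yields the formula.  Only the one-dimensional
   marginals are needed: orthonormality of gamma reduces the completely diagonal
   coefficient to E Q_lj^2.  The normal moments come from the recursion
   M_(n+2) = (n+1) s^2 M_n, by parts on [m - N, m + N] as N tends to infinity. *)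

(** * Central moments of the normal density *)

Lemma cvgn_exprn_expRN_sqr (R : realType) (c : R) (k : nat) : 0 < c ->
  (n%:R ^+ k * expR (- (n%:R ^+ 2 / c)) : R) @[n --> \oo] --> (0 : R).
Proof.
move=> c0; set C : R := c ^+ k.+1 * k.+1`!%:R.
apply: (@squeeze_cvgr _ _ _ _ (cst 0) (fun n : nat => C * n%:R^-1)); last 2 first.
- exact: cvg_cst.
- rewrite -[X in _ --> X](mulr0 C); apply: cvgMl_tmp.
  by rewrite -(cvg_shiftS (fun n : nat => n%:R^-1 : R)); exact: cvg_harmonic.
near=> n; have n0 : (0 : R) < n%:R by rewrite ltr0n; near: n; exists 1%N.
rewrite mulr_ge0 ?exprn_ge0 ?expR_ge0 ?ler0n//= expRN.
rewrite ler_pdivrMr ?expR_gt0// mulrAC ler_pdivlMr//.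
have C0 : 0 < C by rewrite mulr_gt0 ?exprn_gt0// ltr0n fact_gt0.
rewrite -ler_pdivrMl//; apply: le_trans (expR_ge1Dxn k _); last first.
  by rewrite divr_ge0 ?exprn_ge0// ltW.
rewrite ler_wpDl//.
have -> : (n%:R ^+ 2 / c) ^+ k.+1 / k.+1`!%:R = C^-1 * (n%:R ^+ k.+1 * n%:R ^+ k.+1).
  rewrite expr_div_n exprAC expr2 /C; field.
  by rewrite pnatr_eq0 -lt0n fact_gt0 expf_neq0 ?gt_eqF.
rewrite ler_wpM2l ?invr_ge0 ?(ltW C0)// -exprSr ler_peMl ?exprn_ge0//.
by rewrite exprn_ege1// ler1n; near: n; exists 1%N.
Unshelve. all: end_near. Qed.

(** Hence [- s ^+ 2 *: p] is an antiderivative of [(x - m) * p x], the factor integrated by parts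
    below. *)
Lemma is_derive_normal_pdf (R : realType) (m s x : R) : s != 0 ->
  is_derive x 1 (normal_pdf m s) (- ((x - m) / s ^+ 2) * normal_pdf m s x).
Proof.
move=> s0.
rewrite normal_pdfE// /normal_fun.
have H : is_derive x 1 (fun y : R => - (y - m) ^+ 2 / (s ^+ 2 *+ 2))
    (- ((x - m) / s ^+ 2)).
  have -> : (fun y : R => - (y - m) ^+ 2 / (s ^+ 2 *+ 2)) =
    (fun y : R => (- (s ^+ 2 *+ 2)^-1) *: (y - m) ^+ 2).
    by apply/funext => y; rewrite /= mulNr mulrC -mulNr.
  apply: is_derive_eq.
  rewrite /GRing.scale/= subr0; field.
  by rewrite s0.
apply: is_derive_eq.
rewrite /GRing.scale/=; ring.
Qed.

(** For even [n] both integrands are nonnegative, so monotone convergence passes from the compact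
    intervals to the line without any prior integrability. *)
Lemma normal_pdf_central_moment_rec (R : realType) (m s : R) (n : nat) :
  s != 0 -> ~~ odd n ->
  (\int[lebesgue_measure]_x ((x - m) ^+ n.+2 * normal_pdf m s x)%:E =
   (n.+1%:R * s ^+ 2)%:E *
     \int[lebesgue_measure]_x ((x - m) ^+ n * normal_pdf m s x)%:E)%E.
Proof.
move=> s0 evn; set p := normal_pdf m s; set mu := @lebesgue_measure R.
have cp : continuous p by exact: continuous_normal_pdf.
have cX k : continuous (fun x : R => (x - m) ^+ k).
  move=> x; apply: (@continuous_comp _ _ _ (fun x : R => x - m) (fun x => x ^+ k)).
    by apply: cvgB; [exact: cvg_id|exact: cvg_cst].
  exact: exprn_continuous.
have p0 x : 0 <= p x by exact: normal_pdf_ge0.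
have mI k : measurable_fun [set: R] (fun x : R => (x - m) ^+ k * p x).
  apply/measurable_funM; last exact: measurable_normal_pdf.
  by apply: measurable_funX; exact: measurable_funB.
have I0 k x : ~~ odd k -> (0 <= ((x - m) ^+ k * p x)%:E)%E.
  by move=> ek; rewrite lee_fin mulr_ge0// exprn_even_ge0.
pose J (i : nat) : set R := [set` `[m - i%:R, m + i%:R]].
have ndJ : nondecreasing_seq J.
  move=> i j ij; apply/subsetPset => x; rewrite /J/= !in_itv/= => /andP[a b].
  have : (i%:R : R) <= j%:R by rewrite ler_nat.
  by move=> ?; apply/andP; split; lra.
have UJ : \bigcup_i J i = setT.
  apply/seteqP; split => // x _.
  exists (Num.truncn `|x - m|).+1 => //; rewrite /J/= in_itv/=.
  have := truncnS_gt `|x - m|; rewrite ltr_norml => /andP[a b].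
  by apply/andP; split; lra.
have cvgJ k : ~~ odd k -> (\int[mu]_(x in J i) ((x - m) ^+ k * p x)%:E @[i --> \oo]
    --> \int[mu]_x ((x - m) ^+ k * p x)%:E)%E.
  move=> ek; rewrite -UJ; apply: ge0_nondecreasing_set_cvg_integral => //.
  - by move=> i; exact: measurable_itv.
  - by move=> i; apply/measurable_EFinP/measurable_funTS; exact: mI.
  - by move=> i x _; exact: I0.
(* The boundary term: since [n.+1] is odd, the contributions of the two endpoints add up, whence the
   factor 2. *)
pose B (i : nat) : R := - (s ^+ 2 * normal_peak s * 2) *
  (i%:R ^+ n.+1 * expR (- (i%:R ^+ 2 / (s ^+ 2 *+ 2)))).
have B0 : (B i)%:E @[i --> \oo] --> (0 : \bar R)%E.
  apply: cvg_EFin; first by near=> i.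
  rewrite -[X in _ --> X](mulr0 (- (s ^+ 2 * normal_peak s * 2))).
  apply: cvgMl_tmp; apply: cvgn_exprn_expRN_sqr.
  by rewrite pmulrn_lgt0// exprn_even_gt0.
have byparts (i : nat) : (0 < i)%N -> (\int[mu]_(x in J i) ((x - m) ^+ n.+2 * p x)%:E =
    (B i)%:E + (n.+1%:R * s ^+ 2)%:E * \int[mu]_(x in J i) ((x - m) ^+ n * p x)%:E)%E.
  move=> i0; have i0' : (0 : R) < i%:R by rewrite ltr0n.
  have ab : m - i%:R < m + i%:R by lra.
  have dF (x : R) : is_derive x 1 (fun x : R => (x - m) ^+ n.+1) (n.+1%:R * (x - m) ^+ n).
    rewrite (_ : (fun _ => _) = (fun x : R => x - m) ^+ n.+1); last first.
      by apply/funext => y; rewrite fctE.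
    by apply: is_derive_eq; rewrite /GRing.scale/= subr0 mulr1.
  have dG (x : R) : is_derive x 1 (fun x : R => - s ^+ 2 *: p x) ((x - m) * p x).
    have := is_derive_normal_pdf R m s x s0 => ?.
    by apply: is_derive_eq; rewrite /GRing.scale/= -/p; field; rewrite s0.
  have LR (F f : R -> R) : (forall x : R, is_derive x 1 F (f x)) ->
      derivable_oo_LRcontinuous F (m - i%:R) (m + i%:R).
    move=> dFf; have cF : continuous F.
      move=> x; apply/differentiable_continuous/derivable1_diffP.
      exact: (@ex_derive _ _ _ _ _ _ _ (dFf x)).
    split.
    - by move=> x _; exact: (@ex_derive _ _ _ _ _ _ _ (dFf x)).
    - by apply: cvg_at_right_filter; exact: cF.
    - by apply: cvg_at_left_filter; exact: cF.
  have dE (F f : R -> R) : (forall x : R, is_derive x 1 F (f x)) -> derive1 F =1 f.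
    by move=> dFf x; rewrite derive1E; exact: derive_val.
  have parts := @integration_by_parts R (fun x => (x - m) ^+ n.+1)
    (fun x => - s ^+ 2 *: p x) (fun x => n.+1%:R * (x - m) ^+ n)
    (fun x => (x - m) * p x) _ _ ab.
  have -> : (\int[mu]_(x in J i) ((x - m) ^+ n.+2 * p x)%:E =
      \int[mu]_(x in J i) ((x - m) ^+ n.+1 * ((x - m) * p x))%:E)%E.
    by apply: eq_integral => x _; rewrite mulrA -exprSr.
  rewrite parts; last 6 first.
  - apply: continuous_subspaceT => x; apply: cvgM; first exact: cvg_cst.
    exact: cX.
  - exact: LR dF.
  - by move=> x _; exact: dE.
  - apply: continuous_subspaceT => x; apply: cvgM; last exact: cp.
    by apply: cvgB; [exact: cvg_id|exact: cvg_cst].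
  - exact: LR dG.
  - by move=> x _; exact: dE.
  congr (_ + _)%E.
    congr EFin; rewrite /B /p normal_pdfE// /normal_fun /GRing.scale/=.
    rewrite (_ : m + i%:R - m = i%:R); last ring.
    rewrite (_ : m - i%:R - m = - i%:R); last ring.
    rewrite sqrrN exprNn -signr_odd /= (negbTE evn) expr1 !mulNr.
    ring.
  rewrite -ge0_integralZl_EFin//=.
  - rewrite -[RHS]oppeK; congr (- _)%E; rewrite -integral_ge0N/=; last first.
      move=> x _; have := I0 _ x evn; rewrite !lee_fin => ?.
      by apply: mulr_ge0 => //; rewrite mulr_ge0 ?sqr_ge0.
    apply: eq_integral => x _.
    by rewrite /GRing.scale/=; congr EFin; ring.
  - exact: measurable_itv.
  - by move=> x _; exact: I0.
  - by apply/measurable_EFinP/measurable_funTS; exact: mI.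
  - by rewrite mulr_ge0// sqr_ge0.
(* The truncated identity is passed to the limit. It holds for [0 < i], where the interval is
   nondegenerate, so the sequences are compared eventually. *)
have : (\int[mu]_(x in J i) ((x - m) ^+ n.+2 * p x)%:E @[i --> \oo] -->
    0 + (n.+1%:R * s ^+ 2)%:E * \int[mu]_x ((x - m) ^+ n * p x)%:E)%E.
  apply: (@cvg_trans _ ((fun i : nat => (B i)%:E + (n.+1%:R * s ^+ 2)%:E *
      \int[mu]_(x in J i) ((x - m) ^+ n * p x)%:E)%E @ \oo)).
    by apply: near_eq_cvg; near=> i; rewrite byparts//; near: i; exists 1%N.
  apply: cvgeD => //.
  by apply: cvgeZl => //; exact: cvgJ.
rewrite add0e.
move=> h; apply: (cvg_unique _ _ h) => //.
by apply: cvgJ; rewrite /= negbK.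
Unshelve. all: end_near. Qed.

(** The Radon-Nikodym derivative of the normal law and [normal_pdf] have the same integral over
    every measurable set, so they agree almost everywhere. *)
Lemma ge0_integral_normal_prob (R : realType) (m s : R) (f : R -> \bar R) :
  measurable_fun [set: R] f -> (forall x, 0 <= f x)%E ->
  (\int[normal_prob m s]_x f x =
   \int[lebesgue_measure]_x (f x * (normal_pdf m s x)%:E))%E.
Proof.
move=> mf f0; have dom := @normal_prob_dominates R m s.
rewrite -(Radon_Nikodym_SigmaFinite.change_of_variables dom)//.
apply: ae_eq_integral => //.
- apply: emeasurable_funM => //.
  exact: measurable_int (Radon_Nikodym_SigmaFinite.f_integrable dom).
- apply: emeasurable_funM => //; apply/measurable_EFinP.
  exact: measurable_normal_pdf.
- apply: ae_eqe_mul2l.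
  apply: integral_ae_eq => //.
  + exact: Radon_Nikodym_SigmaFinite.f_integrable.
  + by apply/measurable_EFinP; exact: measurable_normal_pdf.
  + by move=> E _ mE; rewrite -Radon_Nikodym_SigmaFinite.f_integral.
Qed.

(** * Bilinearity of the inner product of L^2([0,1]) *)

Section dotH.
Context {R : realType}.
Implicit Types f g h : H R.

Lemma integrable_mulH f g : (leb01 R).-integrable setT (fun x => (f x * g x)%:E).
Proof. by have /Lfun1_integrable := Lfun2_mul_Lfun1 (LfunP f) (LfunP g). Qed.

Lemma dotHC f g : dotH f g = dotH g f.
Proof. by apply: eq_Rintegral => x _; rewrite mulrC. Qed.

Lemma dotHDl f g h : dotH (f + g) h = dotH f h + dotH g h.
Proof.
rewrite /dotH -RintegralD//; try exact: integrable_mulH.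
by apply: eq_Rintegral => x _; rewrite -mulrDl.
Qed.

Lemma dotHZl a f g : dotH (a *: f) g = a * dotH f g.
Proof.
rewrite /dotH -RintegralZl//; last exact: integrable_mulH.
by apply: eq_Rintegral => x _; rewrite mulrA.
Qed.

Lemma dotHZr a f g : dotH f (a *: g) = a * dotH f g.
Proof. by rewrite dotHC dotHZl dotHC. Qed.

Lemma dotHBl f g h : dotH (f - g) h = dotH f h - dotH g h.
Proof. by rewrite dotHDl -scaleN1r dotHZl mulN1r. Qed.

Lemma dotH0l g : dotH 0 g = 0.
Proof. by rewrite -(scale0r (0 : H R)) dotHZl mul0r. Qed.

Lemma dotH_suml (I : Type) (r : seq I) (P : pred I) (F : I -> H R) g :
  dotH (\sum_(i <- r | P i) F i) g = \sum_(i <- r | P i) dotH (F i) g.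
Proof. by elim/big_rec2: _ => [|i y f _ <-]; rewrite ?dotH0l ?dotHDl. Qed.

(** Carries the eigenvector equation, an almost-everywhere equality of representatives, into inner
    products. *)
Lemma eq_dotH_ae f g h : (f : R -> R) = (g : R -> R) %[ae leb01 R] ->
  dotH f h = dotH g h.
Proof.
move=> fg; rewrite /dotH /Rintegral; congr fine; apply: ae_eq_integral => //.
- exact: measurable_int (integrable_mulH f h).
- exact: measurable_int (integrable_mulH g h).
- case: fg => N [mN N0 sN]; exists N; split => // x /= nfg.
  by apply: sN => /= fgx; apply: nfg => _; rewrite fgx.
Qed.

End dotH.

(** * Coordinates for the Hilbert-Schmidt inner product *)

Section dotHS.
Context {R : realType} (gamma : nat -> H R) (q : nat).
Implicit Types A B C : H R -> H R.

Lemma dotHSC A B : dotHS gamma q A B = dotHS gamma q B A.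
Proof. by apply: eq_bigr => i _; rewrite dotHC. Qed.

Lemma dotHSZl a A B : dotHS gamma q (a *: A) B = a * dotHS gamma q A B.
Proof. by rewrite mulr_sumr; apply: eq_bigr => i _; rewrite dotHZl. Qed.

Lemma dotHSDl A B C : dotHS gamma q (A + B) C = dotHS gamma q A C + dotHS gamma q B C.
Proof. by rewrite -big_split; apply: eq_bigr => i _; rewrite dotHDl. Qed.

Lemma dotHS0l A : dotHS gamma q 0 A = 0.
Proof. by rewrite -(scale0r (0 : H R -> H R)) dotHSZl mul0r. Qed.

Lemma dotHS_suml (I : Type) (r : seq I) (P : pred I) (F : I -> H R -> H R) A :
  dotHS gamma q (\sum_(i <- r | P i) F i) A = \sum_(i <- r | P i) dotHS gamma q (F i) A.
Proof. by elim/big_rec2: _ => [|i y f _ <-]; rewrite ?dotHS0l ?dotHSDl. Qed.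

Hypothesis gamma_on : forall i j, dotH (gamma i) (gamma j) = (i == j)%:R.

(** The first operator kills every [gamma l] with [l != k], so one summand survives. *)
Lemma dotHS_tens (i k a b : 'I_q) :
  dotHS gamma q (tens (gamma i) (gamma k)) (tens (gamma a) (gamma b)) =
  ((i == a) && (k == b))%:R.
Proof.
rewrite /dotHS /tens (bigD1 k)//= big1 ?addr0; last first.
  by move=> l; rewrite -val_eqE /= dotHZl gamma_on => /negbTE ->; rewrite mul0r.
rewrite dotHZl dotHZr !gamma_on eqxx mul1r -!val_eqE /=.
by case: eqP => _; case: eqP => _; rewrite ?mulr0 ?mulr1 ?mul0r.
Qed.

(** Reads off coordinates of both [V2] and [meanHS], which have this double-sum form. *)
Lemma dotHS_sum_tens (c : 'I_q -> 'I_q -> R) (a b : 'I_q) :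
  dotHS gamma q (\sum_(i < q) \sum_(k < q) c i k *: tens (gamma i) (gamma k))
    (tens (gamma a) (gamma b)) = c a b.
Proof.
rewrite dotHS_suml (bigD1 a)//= dotHS_suml (bigD1 b)//=.
rewrite dotHSZl dotHS_tens !eqxx mulr1 !big1 ?addr0//.
- move=> i ia; rewrite dotHS_suml big1// => k _.
  by rewrite dotHSZl dotHS_tens (negbTE ia) mulr0.
- by move=> k kb; rewrite dotHSZl dotHS_tens (negbTE kb) andbF mulr0.
Qed.

End dotHS.

(** * Second moment of a shifted squared standard normal *)

(** The square expands into central moments of orders 4, 2 and 0; [0 <= c] keeps each term
    nonnegative, so the integral splits by measurability alone. *)
Lemma integral_normal_prob_sqr_stdD (R : realType) (m s c : R) : s != 0 -> 0 <= c ->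
  (\int[normal_prob m s]_x ((((x - m) / s) ^+ 2 + c) ^+ 2)%:E =
   (3 + 2 * c + c ^+ 2)%:E)%E.
Proof.
move=> s0 c0.
have mX k : measurable_fun [set: R] (fun x : R => (x - m) ^+ k).
  by apply: measurable_funX; exact: measurable_funB.
have p0 x : 0 <= normal_pdf m s x by exact: normal_pdf_ge0.
have mXp k : measurable_fun [set: R] (fun x : R => (x - m) ^+ k * normal_pdf m s x).
  by apply: measurable_funM => //; exact: measurable_normal_pdf.
have X0 k x : ~~ odd k -> (0 <= ((x - m) ^+ k * normal_pdf m s x)%:E)%E.
  by move=> ek; rewrite lee_fin mulr_ge0// exprn_even_ge0.
have M0 : (\int[lebesgue_measure]_x ((x - m) ^+ 0 * normal_pdf m s x)%:E = 1)%E.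
  by under eq_integral do rewrite mul1r; exact: integral_normal_pdf.
(* Two rounds of the recursion from total mass 1 give the moments [s ^+ 2] and [3 * s ^+ 4]. *)
have M2 := normal_pdf_central_moment_rec R m s 0 s0 isT.
have M4 := normal_pdf_central_moment_rec R m s 2 s0 isT.
rewrite M2 M0 mule1 in M4; rewrite M0 mule1 in M2.
rewrite ge0_integral_normal_prob; last 2 first.
- apply/measurable_EFinP; apply: measurable_funX; apply: measurable_funD => //.
  apply: measurable_funX; apply: measurable_funM => //; exact: measurable_funB.
- by move=> x; rewrite lee_fin sqr_ge0.
(* The factor [(x - m) ^+ 0] gives the constant term the same shape as the others, so [mZ], [Z0] and
   [intZ] serve all three. *)
transitivity (\int[lebesgue_measure]_x
  ((s ^- 4)%:E * ((x - m) ^+ 4 * normal_pdf m s x)%:E +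
   (2 * c / s ^+ 2)%:E * ((x - m) ^+ 2 * normal_pdf m s x)%:E +
   (c ^+ 2)%:E * ((x - m) ^+ 0 * normal_pdf m s x)%:E))%E.
  apply: eq_integral => x _; rewrite -!EFinM -!EFinD; congr EFin; field.
  by rewrite s0.
have mZ a k : measurable_fun [set: R]
    (fun x => (a%:E * ((x - m) ^+ k * normal_pdf m s x)%:E)%E).
  by apply/measurable_EFinP; exact: measurable_funM.
have a4 : 0 <= s ^- 4 by rewrite invr_ge0 exprn_even_ge0.
have a2 : 0 <= 2 * c / s ^+ 2.
  by rewrite divr_ge0 ?sqr_ge0// mulr_ge0.
have Z0 a k x : 0 <= a -> ~~ odd k ->
    (0 <= a%:E * ((x - m) ^+ k * normal_pdf m s x)%:E)%E.
  by move=> a0 ek; rewrite mule_ge0// X0.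
rewrite ge0_integralD//; last 4 first.
- by move=> x _; rewrite adde_ge0// Z0.
- by apply: emeasurable_funD; exact: mZ.
- by move=> x _; rewrite Z0// sqr_ge0.
- exact: mZ.
rewrite ge0_integralD//; last 4 first.
- by move=> x _; rewrite Z0.
- exact: mZ.
- by move=> x _; rewrite Z0.
- exact: mZ.
have intZ a k : 0 <= a -> ~~ odd k ->
    (\int[lebesgue_measure]_x (a%:E * ((x - m) ^+ k * normal_pdf m s x)%:E) =
     a%:E * \int[lebesgue_measure]_x ((x - m) ^+ k * normal_pdf m s x)%:E)%E.
  move=> a0 ek; rewrite ge0_integralZl_EFin//.
  - by move=> x _; exact: X0.
  - by apply/measurable_EFinP; exact: mXp.
rewrite !intZ ?sqr_ge0// M0 M2 M4 -!EFinM -!EFinD; congr EFin; field.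
by rewrite s0.
Qed.

(** * Moments of [Q] and the diagonal coefficient *)

Section model.
Context (R : realType) (d : measure_display) (T : measurableType d)
  (P : probability T R).

Lemma ge0_integral_normal_law (Y : T -> R) (m s : R) (f : R -> \bar R) :
  measurable_fun [set: T] Y ->
  (forall A : set (measurableTypeR R), measurable A ->
    P (Y @^-1` A) = normal_prob m s A) ->
  measurable_fun [set: R] f -> (forall x, 0 <= f x)%E ->
  (\int[P]_w f (Y w) = \int[normal_prob m s]_x f x)%E.
Proof.
move=> mY lawY mf f0.
(* [R] and [measurableTypeR R] carry convertible sigma-algebras under
   different displays, hence the casts. *)
have mY' : measurable_fun [set: T] (Y : T -> measurableTypeR R) by exact: mY.
pose mfunY := isMeasurableFun.Build _ _ _ _ _ mY'.
pose Y' : {RV P >-> measurableTypeR R} := HB.pack Y mfunY.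
rewrite -[LHS](ge0_integral_distribution Y' mf f0).
by apply: eq_measure_integral => A mA _; exact: lawY.
Qed.

Context (K : H R -> H R) (gamma : nat -> H R) (lambda : nat -> R).
Context (X : 'I_2 -> T -> H R) (m : 'I_2 -> H R) (alpha : R) (q : nat).
Hypothesis gamma_on : forall i j, dotH (gamma i) (gamma j) = (i == j)%:R.
Hypothesis K_eigen : forall j, (K (gamma j) : R -> R) =
  ((lambda j *: gamma j : H R) : R -> R) %[ae leb01 R].
Hypothesis lambda_gt0 : forall j, 0 < lambda j.
Hypothesis X_gauss : forall l, gaussian_element P (X l) (m l) K.

Local Notation zeta := (zeta gamma lambda X m).
Local Notation nut := (nut gamma lambda m).
Local Notation Q := (Q gamma lambda X m alpha).

Lemma QE (l : 'I_2) (j : 'I_q) w :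
  Q l j w = zeta l j w ^+ 2 + acoef alpha l ^+ 2 * nut j ^+ 2.
Proof. by rewrite /Defs.Q dotHS_sum_tens// !expr2 !mulrA. Qed.

Lemma expectation_Q_sqr (l : 'I_2) (j : 'I_q) :
  ('E_P[fun w => (Q l j w ^+ 2)%R] =
   (3 + 2 * (acoef alpha l ^+ 2 * nut j ^+ 2)
      + (acoef alpha l ^+ 2 * nut j ^+ 2) ^+ 2)%:E)%E.
Proof.
have sl0 : Num.sqrt (lambda j) != 0 by rewrite gt_eqF// sqrtr_gt0.
have [mY lawY] := X_gauss l (gamma j).
rewrite unlock -(integral_normal_prob_sqr_stdD R (dotH (m l) (gamma j))
  (Num.sqrt (lambda j)))//; last first.
  by rewrite mulr_ge0// sqr_ge0.
rewrite -(@ge0_integral_normal_law _ _ _ _ mY).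
- by apply: eq_integral => w _; rewrite QE /Defs.zeta dotHBl.
(* The variance [dotH (K (gamma j)) (gamma j)] reduces to [lambda j], whose positivity selects the
   nondegenerate branch of [gauss_law]. *)
- move=> A mA; rewrite lawY// (eq_dotH_ae _ _ _ (K_eigen j)) dotHZl gamma_on eqxx.
  by rewrite mulr1 /gauss_law gt_eqF.
- apply/measurable_EFinP; apply: measurable_funX; apply: measurable_funD => //.
  apply: measurable_funX; apply: measurable_funM => //; exact: measurable_funB.
- by move=> x; rewrite lee_fin sqr_ge0.
Qed.

Lemma kappaE (j : 'I_q) : (kappa P gamma lambda X m alpha j)%:E =
  (\sum_(l < 2) (prior alpha l)%:E * 'E_P[fun w => (Q l j w ^+ 2)%R])%E.
Proof.
have kE : kappa P gamma lambda X m alpha j =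
    \sum_(l < 2) prior alpha l * fine ('E_P[fun w => (Q l j w ^+ 2)%R]).
  rewrite /kappa /coef4 /V4 dotHS_suml; apply: eq_bigr => l _.
  rewrite dotHSZl /meanHS dotHS_sum_tens//; congr (_ * fine ('E_P[_])).
  (* One factor [Q] is the scalar in [tensHS], the other comes from pairing the scaled operator with
     the same tensor. *)
  by apply/funext => w; rewrite /tensHS dotHSZl dotHSC -expr2.
rewrite kE -sumEFin; apply: eq_bigr => l _.
(* The [fine] inside [meanHS] loses nothing, as the expectation has a real closed form. *)
by rewrite EFinM fineK// expectation_Q_sqr.
Qed.

End model.

(** * Averaging over the two populations *)

Theorem lemma3p2 (R : realType) (d : measure_display) (T : measurableType d)
  (P : probability T R)
  (k : R -> R -> R) (K : H R -> H R)
  (k_cov : covariance_kernel k) (k_cont : kernel_continuous k)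
  (K_ind : induced_by k K)
  (K_sa : self_adjoint K) (K_pos : positive_op K) (K_tr : finite_trace K)
  (gamma : nat -> H R) (lambda : nat -> R)
  (gamma_onb : orthonormal_basis gamma)
  (K_eigen : forall j, (K (gamma j) : R -> R) =
                       ((lambda j *: gamma j : H R) : R -> R) %[ae leb01 R])
  (lambda_dec : forall i j, (i <= j)%N -> lambda j <= lambda i)
  (lambda_gt0 : forall j, 0 < lambda j)
  (m : 'I_2 -> H R) (X : 'I_2 -> T -> H R)
  (X_gauss : forall l, gaussian_element P (X l) (m l) K)
  (alpha : R) (alpha_gt0 : 0 < alpha) (alpha_lt1 : alpha < 1)
  (q : nat) (q_ge1 : (1 <= q)%N) (j : 'I_q) :
  let r := rho alpha in
  let v := nut gamma lambda m j in
  ((kappa P gamma lambda X m alpha j)%:E =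
     \sum_(l < 2) (prior alpha l)%:E *
       'E_P[fun w => (Q gamma lambda X m alpha l j w ^+ 2)%R])%E /\
  (\sum_(l < 2) (prior alpha l)%:E *
       'E_P[fun w => (Q gamma lambda X m alpha l j w ^+ 2)%R] =
     (3 + 2 * r * v ^+ 2 + r * (1 - 3 * r) * v ^+ 4)%R%:E)%E.
Proof.
move=> r v; have [gamma_on _] := gamma_onb.
split; first exact: kappaE.
under eq_bigr do rewrite (@expectation_Q_sqr _ _ _ _ K _ _ _ _ _ _ gamma_on)//.
rewrite !big_ord_recl big_ord0 /prior /acoef /= adde0 -!EFinM -EFinD.
(* The weighted sum of the [acoef] squares is [r], and that of the fourth powers is [r * ((1 -
   alpha) ^+ 3 + alpha ^+ 3) = r * (1 - 3 * r)]. *)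
congr EFin; rewrite -/v /r /rho; ring.
Qed.
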